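(* If $\phi\colon M\to M$ is an endomorphism of a torsion $R$-module $M$, then $\mathrm{ent}_v(\phi)=\widetilde{\mathrm{ent}}_v(\phi)$.
   Context: $R$ is a non-discrete archimedean valuation domain: a valuation domain with field of fractions $Q$ and valuation $v\colon Q\to\Gamma(R)\cup\{\infty\}$ whose value group $\Gamma(R)$ is a dense subgroup of the ordered additive group $\mathbb R$. Put $\mathbb R^*=\mathbb R_{\ge 0}\cup\{\infty\}$. A length function on $\mathrm{Mod}(R)$ is a function $L\colon\mathrm{Mod}(R)\to\mathbb R^*$ with $L(0)=0$, invariant under isomorphism, additive on short exact sequences, and with $L(M)=\sup\{L(F):F\le M\text{ finitely generated}\}$. $L_v$ denotes the (unique) length function on $\mathrm{Mod}(R)$ with $L_v(R/I)=\inf_{r\in I}v(r)$ for every ideal $I$ of $R$ (Northcott–Reufel). For an $R$-module $M$, $\phi\in\mathrm{End}_R(M)$, an $R$-submodule $K\le M$ and $n\ge1$, $T_n(\phi,K)=K+\phi K+\dots+\phi^{n-1}K$. Valuation entropy: for $K\le M$ with $L_v(K)<\infty$ put $\mathrm{ent}_v(\phi,K)=\lim_{n\to\infty}\frac{L_v(T_n(\phi,K))}{n}$ (the limit exists and is finite), and $\mathrm{ent}_v(\phi)=\sup\{\mathrm{ent}_v(\phi,K): K\le M,\ L_v(K)<\infty\}$. Intrinsic valuation entropy: an $R$-submodule $H\le M$ is $\phi$-inert if $L_v((H+\phi H)/H)<\infty$; for such $H$, $\widetilde{\mathrm{ent}}_v(\phi,H)=\lim_{n\to\infty}\frac{L_v(T_n(\phi,H)/H)}{n}$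 (the limit exists and is finite), and $\widetilde{\mathrm{ent}}_v(\phi)=\sup\{\widetilde{\mathrm{ent}}_v(\phi,H): H\le M\ \phi\text{-inert}\}$. *)

(* Defs.v *)
From HB Require Import structures.
From mathcomp Require Import all_boot all_order all_algebra.
From mathcomp Require Import generic_quotient ring_quotient.
From mathcomp Require Import all_classical all_reals all_analysis.
Import Order.TTheory GRing.Theory Num.Theory.
Import numFieldNormedType.Exports.

Set Implicit Arguments.
Unset Strict Implicit.
Unset Printing Implicit Defensive.

Local Open Scope classical_set_scope.
Local Open Scope ring_scope.
Local Open Scope quotient_scope.

(* An R-submodule of M is a bundled closed predicate K : submodClosed M. Its
   Boolean membership is no restriction, as every proposition is decidable by
   the classical axioms of boolp. *)

Section SubmoduleAsModule.
Variables (R : nzRingType) (M : lmodType R) (K : submodClosed M).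

Record submod : Type := Submod { submod_val : M; _ : submod_val \in K }.

HB.instance Definition _ := [isSub for submod_val].
HB.instance Definition _ := [Choice of submod by <:].
HB.instance Definition _ := [SubChoice_isSubLmodule of submod by <:].

End SubmoduleAsModule.

Section QuotientModule.
Variables (R : nzRingType) (M : lmodType R) (K : submodClosed M).

(* submodClosed is a semimodule notion and does not itself carry closure under
   opposite, which the library's quotient of Z-modules requires. *)
Definition zmod_of_submod : {pred M} := mem K.

Lemma zmod_of_submod_closed : GRing.zmod_closed zmod_of_submod.
Proof. exact: GRing.submod_closedB (submodClosedP K). Qed.

HB.instance Definition _ :=
  GRing.isZmodClosed.Build M zmod_of_submod zmod_of_submod_closed.

Definition quotmod : Type := Quotient.quot zmod_of_submod.

HB.instance Definition _ := GRing.Zmodule.on quotmod.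

Definition quotmod_pi (x : M) : quotmod := \pi_(Quotient.quot zmod_of_submod) x.

Definition quotmod_scale (a : R) (x : quotmod) : quotmod :=
  quotmod_pi (a *: repr (x : Quotient.quot zmod_of_submod)).

Lemma quotmod_piE x y : (quotmod_pi x == quotmod_pi y) = (x - y \in K).
Proof. by rewrite /quotmod_pi -Quotient.idealrBE. Qed.

Lemma quotmod_reprK (x : quotmod) :
  quotmod_pi (repr (x : Quotient.quot zmod_of_submod)) = x.
Proof. exact: reprK. Qed.

Lemma quotmod_piD x y : quotmod_pi (x + y) = quotmod_pi x + quotmod_pi y.
Proof. exact: raddfD. Qed.

Lemma quotmod_piZ a x : quotmod_pi (a *: x) = quotmod_scale a (quotmod_pi x).
Proof.
apply/eqP; rewrite quotmod_piE -scalerBr rpredZ // -quotmod_piE.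
by rewrite quotmod_reprK.
Qed.

Lemma quotmod_scaleA a b x :
  quotmod_scale a (quotmod_scale b x) = quotmod_scale (a * b) x.
Proof. by rewrite -[x]quotmod_reprK -!quotmod_piZ scalerA. Qed.

Lemma quotmod_scale1 : left_id 1 quotmod_scale.
Proof. by move=> x; rewrite -[x]quotmod_reprK -quotmod_piZ scale1r. Qed.

Lemma quotmod_scaleDr : right_distributive quotmod_scale +%R.
Proof.
move=> a x y; rewrite -[x]quotmod_reprK -[y]quotmod_reprK.
by rewrite -quotmod_piD -!quotmod_piZ -quotmod_piD scalerDr.
Qed.

Lemma quotmod_scaleDl x : {morph quotmod_scale^~ x : a b / a + b}.
Proof.
by move=> a b; rewrite -[x]quotmod_reprK -!quotmod_piZ scalerDl quotmod_piD.
Qed.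

HB.instance Definition _ := GRing.Zmodule_isLmodule.Build R quotmod
  quotmod_scaleA quotmod_scale1 quotmod_scaleDr quotmod_scaleDl.

End QuotientModule.

Section SubmoduleOperations.
Variables (R : nzRingType) (M : lmodType R).

Definition submod0_pred : {pred M} := pred1 0.

Lemma submod0_closed : GRing.submod_closed submod0_pred.
Proof.
split=> [|a x y]; rewrite !inE // => /eqP -> /eqP ->.
by rewrite scaler0 addr0.
Qed.

HB.instance Definition _ := GRing.isSubmodClosed.Build R M submod0_pred
  submod0_closed.

Definition submod0 : submodClosed M := submod0_pred.

Section Sum.
Variables K H : submodClosed M.

Definition submod_add_pred : {pred M} :=
  fun x => `[< exists y z, [/\ y \in K, z \in H & x = y + z] >].

Lemma submod_add_closed : GRing.submod_closed submod_add_pred.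
Proof.
have closedK := submodClosedP K; have closedH := submodClosedP H.
split=> [|a x x' /asboolP[y [z [yK zH ->]]] /asboolP[y' [z' [yK' zH' ->]]]].
  by apply/asboolP; exists 0, 0; rewrite addr0 closedK.1 closedH.1.
apply/asboolP; exists (a *: y + y'), (a *: z + z').
by rewrite closedK.2 // closedH.2 // scalerDr addrACA.
Qed.

HB.instance Definition _ := GRing.isSubmodClosed.Build R M submod_add_pred
  submod_add_closed.

Definition submod_add : submodClosed M := submod_add_pred.

End Sum.

Section Image.
Variables (phi : {linear M -> M}) (K : submodClosed M).

Definition submod_im_pred : {pred M} :=
  fun x => `[< exists2 y, y \in K & x = phi y >].

Lemma submod_im_closed : GRing.submod_closed submod_im_pred.
Proof.
have closedK := submodClosedP K.
split=> [|a x x' /asboolP[y yK ->] /asboolP[y' yK' ->]].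
  by apply/asboolP; exists 0; rewrite ?closedK.1 // linear0.
by apply/asboolP; exists (a *: y + y'); rewrite ?closedK.2 // linearP.
Qed.

HB.instance Definition _ := GRing.isSubmodClosed.Build R M submod_im_pred
  submod_im_closed.

Definition submod_im : submodClosed M := submod_im_pred.

End Image.

Definition trajectory (phi : {linear M -> M}) (K : submodClosed M) (n : nat) :
    submodClosed M :=
  \big[submod_add/submod0]_(i < n) iter i (submod_im phi) K.

Section Restriction.
Variables K H : submodClosed M.

Definition submod_restr_pred : {pred submod K} := fun x => val x \in H.

Lemma submod_restr_closed : GRing.submod_closed submod_restr_pred.
Proof.
have closedH := submodClosedP H; split=> [|a x y xH yH].
  by rewrite /in_mem /= /submod_restr_pred raddf0 closedH.1.
by rewrite /in_mem /= /submod_restr_pred linearP; apply: closedH.2.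
Qed.

HB.instance Definition _ := GRing.isSubmodClosed.Build R (submod K)
  submod_restr_pred submod_restr_closed.

Definition submod_restr : submodClosed (submod K) := submod_restr_pred.

End Restriction.

(* K / (K :&: H), that is K / H when H is contained in K *)
Definition subquot (K H : submodClosed M) : lmodType R :=
  quotmod (submod_restr K H).

Definition finitely_generated (F : submodClosed M) : Prop :=
  exists (n : nat) (g : 'I_n -> M), (forall i, g i \in F) /\
    forall x, x \in F -> exists c : 'I_n -> R, x = \sum_(i < n) c i *: g i.

Definition torsion_module : Prop :=
  forall x : M, exists2 r : R, r != 0 & r *: x = 0.

End SubmoduleOperations.

Section ValuationDomain.
Variables (RR : realType) (R : idomainType) (v : {fraction R} -> \bar RR).

Record is_valuation : Prop := IsValuation {
  valuation_ninfty : forall x, v x != -oo%E ;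
  valuation_pinfty : forall x, (v x == +oo%E) = (x == 0) ;
  valuationM : forall x y, v (x * y) = (v x + v y)%E ;
  valuationD : forall x y, (Order.min (v x) (v y) <= v (x + y)%R)%E }.

Definition value_group : set RR := [set a | exists x, v x = a%:E].

(* R is the valuation ring of v in its field of fractions, which makes R a
   valuation domain, and the value group is a dense subgroup of the reals
   (archimedean and non-discrete). *)
Record nondiscrete_archimedean_valuation_domain : Prop :=
  NondiscreteArchimedeanValuationDomain {
    navd_valuation : is_valuation ;
    navd_ring : forall x : {fraction R},
      (exists r : R, x = tofrac r) <-> (0 <= v x)%E ;
    navd_dense : dense value_group }.

End ValuationDomain.

Section LengthFunction.
Variables (RR : realType) (R : idomainType) (L : lmodType R -> \bar RR).

Record is_length_function : Prop := IsLengthFunction {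
  length_ge0 : forall M, (0 <= L M)%E ;
  length0 : forall M : lmodType R, (forall x : M, x = 0) -> L M = 0%E ;
  length_iso : forall (M N : lmodType R) (f : {linear M -> N}),
    bijective f -> L M = L N ;
  length_exact : forall (A B C : lmodType R)
      (f : {linear A -> B}) (g : {linear B -> C}),
    injective f -> (forall c, exists b, g b = c) ->
    (forall b, g b = 0 <-> exists a, f a = b) ->
    L B = (L A + L C)%E ;
  length_fg : forall M : lmodType R,
    L M = ereal_sup [set L (submod F) | F in
                      [set F : submodClosed M | finitely_generated F]] }.

(* L = L_v; ideals of R are the submodules of the regular module R^o. *)
Definition is_valuation_length (v : {fraction R} -> \bar RR) : Prop :=
  is_length_function /\
  forall I : submodClosed R^o,
    L (quotmod I) = ereal_inf [set v (tofrac (r : R)) | r in [set r | r \in I]].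

End LengthFunction.

Section Entropy.
Variables (RR : realType) (R : idomainType) (L : lmodType R -> \bar RR).
Variables (M : lmodType R) (phi : {linear M -> M}).

(* The term of index n = 0 has the value 0 and is irrelevant to the limit; lim is
   the library's total operator, used only where the limit exists, namely when
   L (submod K) is finite, respectively when H is inert. *)
Definition ent_at (K : submodClosed M) : \bar RR :=
  limn (fun n => L (submod (trajectory phi K n)) * (n%:R^-1)%:E)%E.

Definition ent : \bar RR :=
  ereal_sup [set ent_at K | K in
              [set K : submodClosed M | (L (submod K) < +oo)%E]].

Definition inert (H : submodClosed M) : Prop :=
  (L (subquot (submod_add H (submod_im phi H)) H) < +oo)%E.

Definition intrinsic_ent_at (H : submodClosed M) : \bar RR :=
  limn (fun n => L (subquot (trajectory phi H n) H) * (n%:R^-1)%:E)%E.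

Definition intrinsic_ent : \bar RR :=
  ereal_sup [set intrinsic_ent_at H | H in [set H | inert H]].

End Entropy.

(* Main.v *)
Require Import Defs.
From HB Require Import structures.
From mathcomp Require Import all_boot all_order all_algebra.
From mathcomp Require Import generic_quotient.
From mathcomp Require Import all_classical all_reals all_analysis.
Import Order.TTheory GRing.Theory Num.Theory.
Import numFieldNormedType.Exports.
Set Implicit Arguments.
Unset Strict Implicit.
Unset Printing Implicit Defensive.
Local Open Scope classical_set_scope.
Local Open Scope ring_scope.

(** Any submodule K of finite length is inert, and
    L (T_n K) = L (K) + L (T_n K / K) for n >= 1, so K has the same entropy in
    both senses ([cvg_ent_at]). This gives one inequality.

    For the other one, let H be inert and e > 0. Since L ((H + phi H) / H) is
    finite and is a supremum over finitely generated submodules, there is a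
    finitely generated F contained in H with
    L ((H + phi H) / (H + phi F)) <= e ([exists_fg_subquot_le]). As M is
    torsion, F has finite length ([length_span_fin]), so it counts in the
    supremum that defines the valuation entropy. By induction on n, L (T_n H / (H + T_n F)) is
    at most (n - 1) e ([trajectory_defect_le]), whence
    L (T_n H / H) <= L (T_n F) + n e ([trajectory_length_approx]). Dividing by n
    and passing to the limit shows that the intrinsic entropy of H exceeds that
    of F by at most e.

    The limits exist because phi induces surjections
    T_(n+1) / T_n -> T_(n+2) / T_(n+1) for n >= 1: the lengths of these
    quotients decrease, and the averages in question are their Cesaro means
    ([cvg_average], [cvg_intrinsic_ent_at]). *)

(** * Linear maps, quotients and submodules *)

Section LinearMaps.
Variable R : nzRingType.

Definition linear_of (U V : lmodType R) (f : U -> V) (fP : linear f) :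
    {linear U -> V} :=
  HB.pack f (GRing.isLinear.Build R U V *:%R f fP).

Definition submod_incl (U : lmodType R) (A : submodClosed U) :
    {linear submod A -> U} := val.

Lemma quotmod_pi_is_linear (U : lmodType R) (A : submodClosed U) :
  linear (@quotmod_pi R U A).
Proof. by move=> a x y; rewrite quotmod_piD quotmod_piZ. Qed.

Definition quotmod_proj (U : lmodType R) (A : submodClosed U) :
    {linear U -> quotmod A} := linear_of (@quotmod_pi_is_linear U A).

Lemma quotmod_proj_surj (U : lmodType R) (A : submodClosed U) (y : quotmod A) :
  exists x, quotmod_proj A x = y.
Proof.
exists (repr (y : Quotient.quot (zmod_of_submod A))); exact: quotmod_reprK.
Qed.

Lemma quotmod_proj_eq0 (U : lmodType R) (A : submodClosed U) (x : U) :
  quotmod_proj A x = 0 <-> x \in A.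
Proof.
have E : (quotmod_proj A x == quotmod_proj A 0) = (x - 0 \in A).
  exact: quotmod_piE.
rewrite linear0 subr0 in E; rewrite -E; split=> [->//|/eqP//].
Qed.

Section KernelImage.
Variables (U V : lmodType R) (f : {linear U -> V}).

Definition lin_ker_pred : {pred U} := fun x => f x == 0.
Lemma lin_ker_closed : GRing.submod_closed lin_ker_pred.
Proof.
split=> [|a x y]; rewrite /in_mem /= /lin_ker_pred; first by rewrite linear0.
by move=> /eqP fx /eqP fy; rewrite linearP fx fy scaler0 addr0.
Qed.
HB.instance Definition _ := GRing.isSubmodClosed.Build R U lin_ker_pred
  lin_ker_closed.
Definition lin_ker : submodClosed U := lin_ker_pred.

Definition lin_im_pred : {pred V} := fun y => `[< exists x, y = f x >].
Lemma lin_im_closed : GRing.submod_closed lin_im_pred.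
Proof.
split=> [|a y z /asboolP[x ->] /asboolP[x' ->]].
  by apply/asboolP; exists 0; rewrite linear0.
by apply/asboolP; exists (a *: x + x'); rewrite linearP.
Qed.
HB.instance Definition _ := GRing.isSubmodClosed.Build R V lin_im_pred
  lin_im_closed.
Definition lin_im : submodClosed V := lin_im_pred.

Lemma lin_kerE x : (x \in lin_ker) = (f x == 0). Proof. by []. Qed.
Lemma lin_imP y : y \in lin_im <-> exists x, y = f x.
Proof. exact: iff_sym (rwP (asboolP _)). Qed.

End KernelImage.

Lemma linear_inj0 (U V : lmodType R) (f : {linear U -> V}) :
  (forall x, f x = 0 -> x = 0) -> injective f.
Proof.
move=> f0 x y fxy; apply/eqP; rewrite -subr_eq0; apply/eqP/f0.
by rewrite linearB fxy subrr.
Qed.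

(** The homomorphism theorem in relational form. It spares every later
    comparison of subquotients the choice of representatives: maps out of
    [subquot A B] are given on [A] and checked there. *)
Lemma linear_factor (U V W : lmodType R) (p : {linear U -> V})
    (g : {linear U -> W}) :
  (forall y, exists x, p x = y) -> (forall x, p x = 0 -> g x = 0) ->
  exists h : {linear V -> W}, forall x, h (p x) = g x.
Proof.
move=> /choice[s sK] kpg.
have gE x x' : p x = p x' -> g x = g x'.
  move=> e; apply/eqP; rewrite -subr_eq0 -linearB; apply/eqP/kpg.
  by rewrite linearB e subrr.
have hP : linear (g \o s).
  by move=> a y z /=; rewrite -linearP; apply: gE; rewrite linearP !sK.
by exists (linear_of hP) => x; apply: gE; rewrite sK.
Qed.

(** Dual to [linear_factor]: a map whose values all lie in the image of an
    injective map corestricts to its source. *)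
Lemma linear_lift (U V W : lmodType R) (i : {linear V -> W})
    (g : {linear U -> W}) :
  injective i -> (forall x, exists y, i y = g x) ->
  exists h : {linear U -> V}, forall x, i (h x) = g x.
Proof.
move=> iI /choice[s sK].
have hP : linear s by move=> a x y; apply: iI; rewrite linearP !sK linearP.
by exists (linear_of hP).
Qed.

End LinearMaps.

Section Submodules.
Variables (R : nzRingType) (M : lmodType R).
Implicit Types A B C : submodClosed M.

Definition subquot_proj A B : {linear submod A -> subquot A B} :=
  quotmod_proj (submod_restr A B).

Lemma subquot_proj_surj A B (y : subquot A B) :
  exists x, subquot_proj A B x = y.
Proof. exact: quotmod_proj_surj. Qed.

Lemma subquot_proj_eq0 A B (x : submod A) :
  subquot_proj A B x = 0 <-> val x \in B.
Proof. exact: quotmod_proj_eq0. Qed.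

Lemma submod_map (f : {linear M -> M}) A B : (forall x, x \in A -> f x \in B) ->
  exists h : {linear submod A -> submod B}, forall x, val (h x) = f (val x).
Proof.
move=> fAB.
have hP : linear (fun x : submod A => Submod (fAB _ (valP x)) : submod B).
  move=> a x y; apply: val_inj.
  by rewrite [RHS](linearP (submod_incl B)) /= linearP.
by exists (linear_of hP).
Qed.

Lemma submod0E x : (x \in submod0 M) = (x == 0). Proof. by []. Qed.

Lemma submod_addP A B x :
  x \in submod_add A B <-> exists y z, [/\ y \in A, z \in B & x = y + z].
Proof. exact: iff_sym (rwP (asboolP _)). Qed.

Lemma submod_imP (phi : {linear M -> M}) A x :
  x \in submod_im phi A <-> exists2 y, y \in A & x = phi y.
Proof. exact: iff_sym (rwP (asboolP _)). Qed.

Lemma submod_add_subl A B : {subset A <= submod_add A B}.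
Proof.
by move=> x xA; apply/submod_addP; exists x, 0; rewrite addr0 rpred0.
Qed.

Lemma submod_add_subr A B : {subset B <= submod_add A B}.
Proof.
by move=> x xB; apply/submod_addP; exists 0, x; rewrite add0r rpred0.
Qed.

Lemma submod_add_le A B C :
  {subset A <= C} -> {subset B <= C} -> {subset submod_add A B <= C}.
Proof.
move=> sAC sBC x /submod_addP[y [z [yA zB ->]]].
by apply: rpredD; [exact: sAC|exact: sBC].
Qed.

Lemma submod_big_incl n (A : 'I_n -> submodClosed M) i :
  {subset A i <= \big[@submod_add R M/submod0 M]_(j < n) A j}.
Proof.
elim: n A i => [|n IH] A i; first by case: i.
rewrite big_ord_recl => x; case: (unliftP ord0 i) => [j ->|->].
  by move=> xA; apply: submod_add_subr; apply: (IH (fun j => A (lift ord0 j)) j).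
exact: submod_add_subl.
Qed.

Lemma submod_im_big (phi : {linear M -> M}) n (A : nat -> submodClosed M) x :
  x \in \big[@submod_add R M/submod0 M]_(i < n) submod_im phi (A i) <->
  x \in submod_im phi (\big[@submod_add R M/submod0 M]_(i < n) A i).
Proof.
elim: n A x => [|n IH] A x.
  rewrite !big_ord0; split.
    rewrite submod0E => /eqP ->; exact: rpred0.
  move=> /submod_imP[y]; rewrite submod0E => /eqP -> ->.
  by rewrite linear0 submod0E.
rewrite !big_ord_recl /=; split.
  move=> /submod_addP[y [z [/submod_imP[y' y'A ->] zA ->]]].
  have /submod_imP[z' z'A ->] := (IH (fun i => A i.+1) z).1 zA.
  apply/submod_imP; exists (y' + z'); last by rewrite linearD.
  by apply/submod_addP; exists y', z'.
move=> /submod_imP[w /submod_addP[y [z [yA zA ->]]] ->].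
rewrite linearD; apply/submod_addP; exists (phi y), (phi z); split => //.
  by apply/submod_imP; exists y.
by apply: (IH (fun i => A i.+1) _).2; apply/submod_imP; exists z.
Qed.

(** * Trajectories *)

Section Trajectory.
Variables (phi : {linear M -> M}) (K : submodClosed M).
Local Notation T := (trajectory phi K).

Lemma trajectory0 x : (x \in T 0) = (x == 0).
Proof. by rewrite /trajectory big_ord0. Qed.

(** The recursion T_(n+1) = K + phi T_n, on which every later induction on
    trajectories rests. *)
Lemma trajectoryS n x :
  x \in T n.+1 <-> x \in submod_add K (submod_im phi (T n)).
Proof.
rewrite /trajectory big_ord_recl /=; split=> /submod_addP[y [z [yK zT ->]]];
  apply/submod_addP; exists y, z; split => //.
  exact: (submod_im_big phi n (fun i => iter i (submod_im phi) K) z).1 zT.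
exact: (submod_im_big phi n (fun i => iter i (submod_im phi) K) z).2 zT.
Qed.

Lemma trajectory_base n : {subset K <= T n.+1}.
Proof. by move=> x xK; apply/trajectoryS; exact: submod_add_subl. Qed.

Lemma trajectory_phi n x : x \in T n -> phi x \in T n.+1.
Proof.
move=> xT; apply/trajectoryS; apply: submod_add_subr.
by apply/submod_imP; exists x.
Qed.

Lemma trajectory_incr n : {subset T n <= T n.+1}.
Proof.
elim: n => [|n IH] x; first by rewrite trajectory0 => /eqP ->; exact: rpred0.
move=> /trajectoryS/submod_addP[y [z [yK /submod_imP[w wT ->] ->]]].
apply: rpredD; first exact: trajectory_base.
by apply: trajectory_phi; exact: IH.
Qed.

Lemma trajectory1 x : (x \in T 1) = (x \in K).
Proof.
apply/idP/idP => [|/trajectory_base//].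
move=> /trajectoryS/submod_addP[y [z [yK /submod_imP[w]]]].
by rewrite trajectory0 => /eqP -> ->; rewrite linear0 => ->; rewrite addr0.
Qed.

End Trajectory.

Lemma trajectory_mono (phi : {linear M -> M}) (K H : submodClosed M) n :
  {subset K <= H} ->
  {subset trajectory phi K n <= trajectory phi H n}.
Proof.
move=> sKH; elim: n => [|n IH] x; first by rewrite !trajectory0.
move=> /trajectoryS/submod_addP[y [z [yK /submod_imP[w wT ->] ->]]].
apply: rpredD; first by apply: trajectory_base; exact: sKH.
by apply: trajectory_phi; exact: IH.
Qed.

End Submodules.

(** * Lengths of subquotients *)

Section Length.
Variables (RR : realType) (R : idomainType) (L : lmodType R -> \bar RR).
Hypothesis LP : is_length_function L.
Local Open Scope ereal_scope.

Lemma length_ker (A B : lmodType R) (g : {linear A -> B}) :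
  (forall y, exists x, g x = y) -> L A = L (submod (lin_ker g)) + L B.
Proof.
move=> gS.
apply: (length_exact LP (f := submod_incl (lin_ker g)) _ gS).
  exact: val_inj.
move=> b; split=> [gb0|[a <-]]; last by apply/eqP; exact: (valP a).
have bK : b \in lin_ker g by rewrite lin_kerE gb0.
by exists (Submod bK).
Qed.

Lemma length_surj_le (A B : lmodType R) (g : {linear A -> B}) :
  (forall y, exists x, g x = y) -> L B <= L A.
Proof. by move=> /length_ker ->; rewrite leeDr ?(length_ge0 LP). Qed.

Lemma length_inj_le (A B : lmodType R) (f : {linear A -> B}) :
  injective f -> L A <= L B.
Proof.
move=> fI.
rewrite (length_exact LP (g := quotmod_proj (lin_im f)) fI).
- by rewrite leeDl ?(length_ge0 LP).
- exact: quotmod_proj_surj.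
move=> b; split=> [/quotmod_proj_eq0/lin_imP[a ->]|[a <-]]; first by exists a.
by apply/quotmod_proj_eq0/lin_imP; exists a.
Qed.

Lemma length_factor_le (U V W : lmodType R) (p : {linear U -> V})
    (g : {linear U -> W}) :
  (forall y, exists x, p x = y) -> (forall y, exists x, g x = y) ->
  (forall x, p x = 0%R -> g x = 0%R) -> L W <= L V.
Proof.
move=> pS gS /(linear_factor pS)[h hE]; apply: (length_surj_le (g := h)).
by move=> w; have [u <-] := gS w; exists (p u).
Qed.

Section Subquotients.
Variable M : lmodType R.
Implicit Types A B C : submodClosed M.
Local Notation q A B := (L (subquot A B)).

Lemma length_subquot_ge0 A B : 0 <= q A B. Proof. exact: length_ge0. Qed.

(** The hypotheses say that [f] induces a surjection from A / (A :&: B) onto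
    A' / (A' :&: B'). It is applied with [f] the identity or the given
    endomorphism. *)
Lemma length_subquot_map_le (f : {linear M -> M}) A B A' B' :
  (forall x, x \in A -> f x \in A') ->
  (forall x, x \in A -> x \in B -> f x \in B') ->
  (forall y, y \in A' -> exists x z, [/\ x \in A, z \in B' & y = f x + z]%R) ->
  q A' B' <= q A B.
Proof.
move=> /submod_map[h hE] fB fS.
apply: (length_factor_le (p := subquot_proj A B)
  (g := subquot_proj A' B' \o h)); first exact: subquot_proj_surj.
  move=> y; have [a <-] := subquot_proj_surj y.
  have [x [z [xA zB' e]]] := fS _ (valP a).
  exists (Submod xA); apply/esym/eqP; rewrite -subr_eq0.
  suff : subquot_proj A' B' (a - h (Submod xA))%R = 0%R.
    by rewrite linearB => ->.
  apply/subquot_proj_eq0.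
  by rewrite linearB /= [submod_val (h _)]hE e /= addrC addKr.
move=> x /subquot_proj_eq0 xB; apply/subquot_proj_eq0.
by rewrite hE; apply: fB => //; exact: (valP x).
Qed.

(** Here the surjection is the one of the second isomorphism theorem, which
    sends A onto (A + B') / B'. *)
Lemma length_subquot_le A B A' B' :
  {subset A <= A'} -> {subset B <= B'} -> {subset A' <= submod_add A B'} ->
  q A' B' <= q A B.
Proof.
move=> sAA' sBB' sA'; apply: (length_subquot_map_le (f := idfun)) => [x|x _|y] /=.
- exact: sAA'.
- exact: sBB'.
by move=> /sA'/submod_addP[x [z [xA zB ->]]]; exists x, z.
Qed.

(** The third isomorphism theorem, as the exact sequence
    0 -> B / C -> A / C -> A / B -> 0. *)
Lemma length_subquotD A B C : {subset C <= B} -> {subset B <= A} ->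
  q A C = q B C + q A B.
Proof.
move=> sCB sBA.
have [i iE] := submod_map (f := idfun) sBA.
have [j jE] : exists j : {linear subquot B C -> subquot A C},
    forall x, j (subquot_proj B C x) = subquot_proj A C (i x).
  apply: (linear_factor (g := subquot_proj A C \o i)).
    exact: subquot_proj_surj.
  by move=> x /subquot_proj_eq0 xC; apply/subquot_proj_eq0; rewrite iE.
have [k kE] : exists k : {linear subquot A C -> subquot A B},
    forall x, k (subquot_proj A C x) = subquot_proj A B x.
  apply: linear_factor; first exact: subquot_proj_surj.
  by move=> x /subquot_proj_eq0 xC; apply/subquot_proj_eq0; exact: sCB.
apply: (length_exact LP (f := j) (g := k)).
- apply: linear_inj0 => y; have [x <-] := subquot_proj_surj y.
  by rewrite jE => /subquot_proj_eq0; rewrite iE => xC; apply/subquot_proj_eq0.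
- move=> y; have [x <-] := subquot_proj_surj y.
  by exists (subquot_proj A C x).
move=> y; have [x <-] := subquot_proj_surj y; rewrite kE; split.
  move=> /subquot_proj_eq0 xB; exists (subquot_proj B C (Submod xB)).
  by rewrite jE; congr (subquot_proj A C _); apply: val_inj; rewrite iE.
move=> [z]; have [w <-] := subquot_proj_surj z; rewrite jE => e.
rewrite -kE -e kE; apply/subquot_proj_eq0; rewrite iE; exact: (valP w).
Qed.

Lemma length_subquot_eq0 A B : {subset A <= B} -> q A B = 0.
Proof.
move=> sAB; apply: (length0 LP) => y; have [x <-] := subquot_proj_surj y.
by apply/subquot_proj_eq0; apply: sAB; exact: (valP x).
Qed.

Lemma length_subquot0 A : q A (submod0 M) = L (submod A).
Proof.
apply/esym/(length_iso LP (f := subquot_proj A (submod0 M))).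
have I : injective (subquot_proj A (submod0 M)).
  apply: linear_inj0 => x /subquot_proj_eq0; rewrite submod0E => /eqP e.
  exact: val_inj.
have [s sK] := choice (@subquot_proj_surj _ _ A (submod0 M)).
by exists s => // x; apply: I; rewrite sK.
Qed.

Lemma length_submodD A B :
  {subset B <= A} -> L (submod A) = L (submod B) + q A B.
Proof.
move=> sBA; rewrite -2!length_subquot0; apply: length_subquotD => // x.
by rewrite submod0E => /eqP ->; exact: rpred0.
Qed.

Lemma length_subquot_addl_le A B : q (submod_add A B) B <= L (submod A).
Proof.
rewrite -length_subquot0; apply: length_subquot_le => [||//].
  exact: submod_add_subl.
by move=> x; rewrite submod0E => /eqP ->; exact: rpred0.
Qed.

Lemma length_subquot_addr_le A B : q (submod_add A B) A <= L (submod B).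
Proof.
rewrite -length_subquot0; apply: length_subquot_le; first exact: submod_add_subr.
  by move=> x; rewrite submod0E => /eqP ->; exact: rpred0.
move=> x /submod_addP[y [z [yA zB ->]]]; apply/submod_addP; exists z, y.
by rewrite addrC.
Qed.

Lemma length_submod_add_fin A B : L (submod A) < +oo -> L (submod B) < +oo ->
  L (submod (submod_add A B)) < +oo.
Proof.
move=> LA LB; rewrite (length_submodD (@submod_add_subr _ _ A B)).
by rewrite lte_add_pinfty// (le_lt_trans (length_subquot_addl_le A B)).
Qed.

Lemma length_submod_im_fin (f : {linear M -> M}) A : L (submod A) < +oo ->
  L (submod (submod_im f A)) < +oo.
Proof.
apply: le_lt_trans.
have [|h hE] := @submod_map _ _ f A (submod_im f A).
  by move=> x xA; apply/submod_imP; exists x.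
apply: (length_surj_le (g := h)) => y.
have /submod_imP[x xA e] := valP y.
by exists (Submod xA); apply: val_inj; rewrite hE e.
Qed.

(** The length of (H + G) / H is a supremum over finitely generated submodules,
    so one of them, F, has length within [e] of it. Each generator of F is the
    class of an element of [G]; these representatives are the [g i]. Once G'
    contains them, (H + G') / H contains F, and additivity leaves at most [e]
    for (H + G) / (H + G'). The statement is left open in G' so that G' can be
    taken to be the image under the endomorphism of a finitely generated
    submodule. *)
Lemma exists_fg_subquot_le H G (e : RR) :
  q (submod_add H G) H < +oo -> (0 < e)%R ->
  exists n (g : 'I_n -> M), (forall i, g i \in G) /\
    forall G' : submodClosed M, {subset G' <= G} -> (forall i, g i \in G') ->
      q (submod_add H G) (submod_add H G') <= e%:E.
Proof.
set A := submod_add H G => qfin e0.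
have qfn : q A H \is a fin_num by rewrite ge0_fin_numE// length_subquot_ge0.
have supE := length_fg LP (subquot A H).
have [_ [F [n [y [yF Fgen]]] <-]] :=
  ub_ereal_sup_adherent e0 (eq_ind _ (fun z => z \is a fin_num) qfn _ supE).
rewrite -supE => Fgt.
have /choice[g gP] : forall i, exists g, g \in G /\
    exists a : submod A, subquot_proj A H a = y i /\ (val a - g)%R \in H.
  move=> i; have [a aE] := subquot_proj_surj (y i).
  have /submod_addP[h [g [hH gG ae]]] := valP a.
  by exists g; split=> //; exists a; split=> //; rewrite ae addrK.
exists n, g; split=> [i|G' sG' gG']; first by have [] := gP i.
set B := submod_add H G'.
have sHB : {subset H <= B} by exact: submod_add_subl.
have sBA : {subset B <= A}.
  apply: submod_add_le; first exact: submod_add_subl.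
  by move=> x /sG'; exact: submod_add_subr.
have [i iE] := submod_map (f := idfun) sBA.
have [j jE] : exists j : {linear subquot B H -> subquot A H},
    forall x, j (subquot_proj B H x) = subquot_proj A H (i x).
  apply: (linear_factor (g := subquot_proj A H \o i)).
    exact: subquot_proj_surj.
  by move=> x /subquot_proj_eq0 xC; apply/subquot_proj_eq0; rewrite iE.
have jI : injective j.
  apply: linear_inj0 => z; have [x <-] := subquot_proj_surj z.
  by rewrite jE => /subquot_proj_eq0; rewrite iE => xC; apply/subquot_proj_eq0.
have yj k : exists z, j z = y k.
  have [_ [a [ay aH]]] := gP k.
  have aB : val a \in B.
    rewrite -[val a](subrK (g k)); apply: rpredD; first exact: sHB.
    exact: submod_add_subr.
  exists (subquot_proj B H (Submod aB)); rewrite jE -ay.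
  by congr (subquot_proj A H _); apply: val_inj; rewrite iE.
have LF : L (submod F) <= q B H.
  have [|h hE] := linear_lift (g := submod_incl F) jI.
    move=> x; have [c /= ->] := Fgen _ (valP x).
    have /choice[z zE] := yj.
    exists (\sum_(k < n) c k *: z k)%R; rewrite linear_sum.
    by apply: eq_bigr => k _; rewrite linearZ /= zE.
  apply: (length_inj_le (f := h)) => x x' e'; apply: val_inj.
  by have := congr1 j e'; rewrite !hE.
have qE := length_subquotD sHB sBA.
have qAB : q A B \is a fin_num.
  rewrite ge0_fin_numE ?length_subquot_ge0// (le_lt_trans _ qfin)// qE.
  by rewrite leeDr ?length_subquot_ge0.
have qBH : q B H \is a fin_num.
  rewrite ge0_fin_numE ?length_subquot_ge0// (le_lt_trans _ qfin)// qE.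
  by rewrite leeDl ?length_subquot_ge0.
have := lt_le_trans Fgt LF; rewrite qE.
rewrite -(fineK qAB) -(fineK qBH) -EFinD lte_fin lee_fin.
by move=> ?; rewrite -(lerD2l (fine (q B H))) -lerBlDr ltW.
Qed.

End Subquotients.
End Length.

(** * Finitely generated torsion modules have finite length *)

Section ValuationLength.
Variables (RR : realType) (R : idomainType) (v : {fraction R} -> \bar RR).
Hypothesis hv : is_valuation v.
Variables (L : lmodType R -> \bar RR).
Hypothesis hL : is_valuation_length L v.
Variable M : lmodType R.
Hypothesis hM : torsion_module M.

Lemma scale_linear (x : M) : linear (fun r : R^o => (r : R) *: x).
Proof. by move=> a r s; rewrite scalerDl scalerA. Qed.

Definition cyclic (x : M) : submodClosed M :=
  lin_im (linear_of (@scale_linear x)).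

Lemma mem_cyclic x : x \in cyclic x.
Proof. by apply/lin_imP; exists 1; rewrite /= scale1r. Qed.

Lemma cyclic_sub (A : submodClosed M) x : x \in A -> {subset cyclic x <= A}.
Proof. by move=> xA y /lin_imP[r ->]; exact: rpredZ. Qed.

(** The only place where torsion enters: the cyclic module on [x] is R / ann(x),
    whose length is at most v(r) for any nonzero r that kills [x]. *)
Lemma length_cyclic_fin x : (L (submod (cyclic x)) < +oo)%E.
Proof.
have [LP LE] := hL; have [r r0 rx] := hM x.
pose f := linear_of (@scale_linear x).
apply: (@le_lt_trans _ _ (L (quotmod (lin_ker f)))).
  have [h hE] : exists h : {linear R^o -> submod (cyclic x)},
      forall r, val (h r) = f r.
    apply: (linear_lift (i := submod_incl (cyclic x))); first exact: val_inj.
    move=> s; have fs : f s \in cyclic x by apply/lin_imP; exists s.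
    by exists (Submod fs).
  apply: (length_factor_le LP (p := quotmod_proj (lin_ker f)) (g := h)).
  - exact: quotmod_proj_surj.
  - move=> y; have /lin_imP[s e] := valP y.
    by exists s; apply: val_inj; rewrite [LHS]hE e.
  - move=> s /quotmod_proj_eq0; rewrite lin_kerE => /eqP fs0; apply: val_inj.
    by rewrite [LHS]hE fs0.
rewrite LE; apply: (@le_lt_trans _ _ (v (tofrac r))).
  by apply: ereal_inf_lbound; exists r => //=; rewrite lin_kerE /= rx.
by rewrite ltey (valuation_pinfty hv) tofrac_eq0.
Qed.

Definition submod_span n (g : 'I_n -> M) : submodClosed M :=
  \big[@submod_add R M/submod0 M]_(i < n) cyclic (g i).

Lemma mem_span n (g : 'I_n -> M) i : g i \in submod_span g.
Proof.
exact: (@submod_big_incl _ _ _ (fun i => cyclic (g i)) i) (mem_cyclic _).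
Qed.

Lemma span_sub n (g : 'I_n -> M) (A : submodClosed M) :
  (forall i, g i \in A) -> {subset submod_span g <= A}.
Proof.
move=> gA; rewrite /submod_span.
apply: (big_ind (fun B : submodClosed M => {subset B <= A})).
- by move=> x; rewrite submod0E => /eqP ->; exact: rpred0.
- by move=> B C; exact: submod_add_le.
by move=> i _; exact: cyclic_sub.
Qed.

Lemma length_span_fin n (g : 'I_n -> M) : (L (submod (submod_span g)) < +oo)%E.
Proof.
have [LP _] := hL; rewrite /submod_span.
apply: (big_ind (fun B : submodClosed M => (L (submod B) < +oo)%E)).
- rewrite (length0 LP) ?ltry// => x; apply: val_inj; apply/eqP; exact: (valP x).
- by move=> B C; exact: (length_submod_add_fin LP).
by move=> i _; exact: length_cyclic_fin.
Qed.

End ValuationLength.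

(** * Existence of the limits *)

(** The increments decrease from index 1 on, hence converge, and [u n / n] is
    their Cesaro mean. The increment at index 0 is left out of the monotonicity
    hypothesis because for u n = L (T_n / H) it vanishes, T_0 and T_1 being both
    contained in H. *)
Lemma cvg_average (RR : realType) (u : nat -> RR) : u 0%N = 0 ->
  (forall n, u n <= u n.+1) ->
  (forall n, u n.+3 - u n.+2 <= u n.+2 - u n.+1) ->
  cvgn (fun n => u n * n%:R^-1).
Proof.
move=> u0 u_incr u_concave.
have /cvg_ex[l] : cvgn [sequence telescope u n.+1]_n.
  apply: nonincreasing_is_cvgn; first exact/nonincreasing_seqP.
  by exists 0 => _ [n _ <-]; rewrite /= subr_ge0.
rewrite (cvg_shiftS (telescope u)) => /cesaro meanl.
apply/cvg_ex; exists l; rewrite -(cvg_shiftS (fun n => u n * n%:R^-1)).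
apply: cvg_trans meanl; apply: near_eq_cvg; apply: nearW => n.
by rewrite /arithmetic_mean /= telescopeK /= u0 subr0 mulrC.
Qed.

Section TrajectoryLength.
Variables (RR : realType) (R : idomainType) (L : lmodType R -> \bar RR).
Hypothesis LP : is_length_function L.
Variables (M : lmodType R) (phi : {linear M -> M}).
Local Open Scope ereal_scope.
Local Notation q A B := (L (@subquot R M A B)).
Local Notation T := (trajectory phi).

Section Inert.
Variable H : submodClosed M.
Hypothesis Hin : inert L phi H.

Lemma trajectory_length_add n :
  q (T H n.+2) H = q (T H n.+1) H + q (T H n.+2) (T H n.+1).
Proof.
by apply: (length_subquotD LP); [exact: trajectory_base|exact: trajectory_incr].
Qed.

(** The endomorphism maps T_(n+2) / T_(n+1) onto T_(n+3) / T_(n+2), because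
    T_(n+3) = H + phi T_(n+2) and H lies in T_(n+2). *)
Lemma trajectory_increment_decr n :
  q (T H n.+3) (T H n.+2) <= q (T H n.+2) (T H n.+1).
Proof.
apply: (length_subquot_map_le LP (f := phi)) => [x|x _|y].
- exact: trajectory_phi.
- exact: trajectory_phi.
move=> /trajectoryS/submod_addP[h [z [hH /submod_imP[x xT ->] ->]]].
exists x, h; rewrite addrC; split=> //; exact: trajectory_base.
Qed.

Lemma trajectory_increment_fin n : q (T H n.+2) (T H n.+1) < +oo.
Proof.
elim: n => [|n]; last exact/le_lt_trans/trajectory_increment_decr.
apply: le_lt_trans Hin; apply: (length_subquot_le LP).
- apply: submod_add_le => x; first exact: trajectory_base.
  by move=> /submod_imP[y yH ->]; apply: trajectory_phi; exact: trajectory_base.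
- exact: trajectory_base.
move=> x /trajectoryS/submod_addP[h [z [hH /submod_imP[y yT ->] ->]]].
apply: submod_add_subl; apply/submod_addP; exists h, (phi y); split=> //.
by apply/submod_imP; exists y => //; rewrite -(trajectory1 phi).
Qed.

Lemma trajectory_length_fin n : q (T H n) H < +oo.
Proof.
case: n => [|n]; last elim: n => [|n IH].
- rewrite (length_subquot_eq0 LP) ?ltry// => x.
  by rewrite trajectory0 => /eqP ->; exact: rpred0.
- by rewrite (length_subquot_eq0 LP) ?ltry// => x; rewrite trajectory1.
by rewrite trajectory_length_add lte_add_pinfty// trajectory_increment_fin.
Qed.

Lemma cvg_intrinsic_ent_at : exists l : RR,
  (fun n => q (T H n) H * (n%:R^-1)%:E) @ \oo --> l%:E.
Proof.
pose u n := fine (q (T H n) H).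
have uE n : q (T H n) H = (u n)%:E.
  rewrite fineK// ge0_fin_numE ?trajectory_length_fin//.
  exact: (length_subquot_ge0 LP).
pose d n := fine (q (T H n.+2) (T H n.+1)).
have dE n : q (T H n.+2) (T H n.+1) = (d n)%:E.
  rewrite fineK// ge0_fin_numE ?trajectory_increment_fin//.
  exact: (length_subquot_ge0 LP).
have uS n : (u n.+2 = u n.+1 + d n)%R.
  by apply: EFin_inj; rewrite EFinD -!uE -dE trajectory_length_add.
have u0 : u 0%N = 0%R.
  rewrite /u (length_subquot_eq0 LP)// => x.
  by rewrite trajectory0 => /eqP ->; exact: rpred0.
have u1 : u 1%N = 0%R.
  by rewrite /u (length_subquot_eq0 LP)// => x; rewrite trajectory1.
have /cvg_ex[l ul] : cvgn (fun n => u n * n%:R^-1)%R.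
  apply: cvg_average => // [[|n]|n].
  - by rewrite u0 u1.
  - by rewrite uS lerDl -lee_fin -dE (length_subquot_ge0 LP).
  have dS m : (u m.+2 - u m.+1 = d m)%R by rewrite uS addrAC subrr add0r.
  by rewrite !dS -lee_fin -!dE trajectory_increment_decr.
exists l; under eq_fun do rewrite uE -EFinM.
exact: cvg_EFin (nearW _ _) ul.
Qed.

End Inert.

Lemma inert_of_fin K : L (submod K) < +oo -> inert L phi K.
Proof.
move=> LK; apply: le_lt_trans (length_submod_im_fin LP phi LK).
exact: (length_subquot_addr_le LP).
Qed.

(** For K of finite length, L (T_n) and L (T_n / K) differ by the constant
    L (K), which disappears after division by n; so both averages have the same
    limit. *)
Lemma cvg_ent_at K (l : RR) : L (submod K) < +oo ->
  (fun n => q (T K n) K * (n%:R^-1)%:E) @ \oo --> l%:E ->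
  (fun n => L (submod (T K n)) * (n%:R^-1)%:E) @ \oo --> l%:E.
Proof.
move=> LK; have LKE : L (submod K) = (fine (L (submod K)))%:E.
  by rewrite fineK// ge0_fin_numE// (length_ge0 LP).
move=> ql; rewrite -cvg_shiftS.
have {}ql : (fun n => q (T K n.+1) K * (n.+1%:R^-1)%:E) @ \oo --> l%:E.
  by move: ql; rewrite -cvg_shiftS.
under eq_fun => n.
  rewrite (length_submodD LP (@trajectory_base _ _ phi K n)).
  rewrite ge0_muleDl ?(length_ge0 LP)// ?(length_subquot_ge0 LP)// LKE -EFinM.
  over.
have K0 : (fun n => (fine (L (submod K)) * n.+1%:R^-1)%:E) @ \oo --> 0%:E.
  apply: cvg_EFin; first exact: nearW.
  rewrite -(mulr0 (fine (L (submod K)))); apply: cvgMr; exact: cvg_harmonic.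
by have := cvgeD (fin_num_adde_defl _ _) K0 ql; rewrite add0e; apply.
Qed.

(** * Approximating an inert submodule from inside *)

(** Replacing H by F in the trajectory costs at most [e] per step. Between
    H + T_(n+2)(F) and T_(n+2)(H) lies Z = (H + phi H) + T_(n+2)(F): the
    endomorphism maps the defect of the previous step onto T_(n+2)(H) / Z, and
    Z / (H + T_(n+2)(F)) is a quotient of (H + phi H) / (H + phi F). *)
Lemma trajectory_defect_le (H F : submodClosed M) (e : RR) :
  {subset F <= H} ->
  q (submod_add H (submod_im phi H)) (submod_add H (submod_im phi F)) <= e%:E ->
  forall n, q (T H n.+1) (submod_add H (T F n.+1)) <= (n%:R * e)%:E.
Proof.
move=> sFH qe; elim=> [|n IH].
  rewrite mul0r (length_subquot_eq0 LP)// => x; rewrite trajectory1.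
  exact: submod_add_subl.
set X := T H n.+2; set Y := submod_add H (T F n.+2).
pose Z := submod_add (submod_add H (submod_im phi H)) Y.
have sYZ : {subset Y <= Z} by exact: submod_add_subr.
have sHZ : {subset H <= Z}.
  by move=> x xH; apply: sYZ; exact: submod_add_subl.
have sHX : {subset H <= X} by exact: trajectory_base.
have sZX : {subset Z <= X}.
  apply: submod_add_le; apply: submod_add_le => //.
    move=> x /submod_imP[y yH ->]; apply: trajectory_phi.
    exact: trajectory_base.
  exact: trajectory_mono.
rewrite (length_subquotD LP sYZ sZX) mulrSr mulrDl mul1r EFinD addeC.
apply: leeD; last first.
  apply: le_trans IH; apply: (length_subquot_map_le LP (f := phi)) => [x|x _|y].
  - exact: trajectory_phi.
  - move=> /submod_addP[h [t [hH tF ->]]]; rewrite linearD; apply: rpredD.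
      apply: submod_add_subl; apply: submod_add_subr.
      by apply/submod_imP; exists h.
    by apply: sYZ; apply: submod_add_subr; exact: trajectory_phi.
  move=> /trajectoryS/submod_addP[h [z [hH /submod_imP[x xT ->] ->]]].
  by exists x, h; rewrite addrC; split=> //; exact: sHZ.
apply: le_trans qe; apply: (length_subquot_le LP) => //; first exact: submod_add_subl.
apply: submod_add_le; first exact: submod_add_subl.
move=> x /submod_imP[y yF ->]; apply: submod_add_subr.
by apply: trajectory_phi; exact: trajectory_base.
Qed.

Lemma trajectory_length_approx (H F : submodClosed M) (e : RR) :
  {subset F <= H} -> (0 <= e)%R ->
  q (submod_add H (submod_im phi H)) (submod_add H (submod_im phi F)) <= e%:E ->
  forall n, q (T H n.+1) H <= L (submod (T F n.+1)) + (n.+1%:R * e)%:E.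
Proof.
move=> sFH e0 qe n; have sHB := @submod_add_subl _ _ H (T F n.+1).
have sBT : {subset submod_add H (T F n.+1) <= T H n.+1}.
  by apply: submod_add_le; [exact: trajectory_base|exact: trajectory_mono].
rewrite (length_subquotD LP sHB sBT); apply: leeD.
  exact: (length_subquot_addr_le LP).
apply: le_trans (trajectory_defect_le sFH qe n) _.
by rewrite lee_fin ler_wpM2r// ler_nat.
Qed.

End TrajectoryLength.

(** * The two entropies agree on torsion modules *)

Theorem proposition2p14 (RR : realType) (R : idomainType)
    (v : {fraction R} -> \bar RR)
    (hR : nondiscrete_archimedean_valuation_domain v)
    (Lv : lmodType R -> \bar RR) (hLv : is_valuation_length Lv v)
    (M : lmodType R) (hM : torsion_module M) (phi : {linear M -> M}) :
  ent Lv phi = intrinsic_ent Lv phi.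
Proof.
have LP := hLv.1; apply/eqP; rewrite eq_le; apply/andP; split.
  apply: ge_ereal_sup => _ [K /= LK <-].
  have Kin := inert_of_fin LP phi LK.
  have [l Kl] := cvg_intrinsic_ent_at LP Kin.
  apply: ereal_sup_ubound; exists K => //.
  rewrite /ent_at /intrinsic_ent_at (cvg_lim _ Kl)//.
  by rewrite (cvg_lim _ (cvg_ent_at LP LK Kl)).
apply: ge_ereal_sup => _ [H /= Hin <-].
apply/lee_addgt0Pr => e e0.
(* F is spanned by preimages in H of the generators that approximate
   (H + phi H) / H, so that phi F contains those generators. *)
have [n [g [gH gP]]] := exists_fg_subquot_le LP Hin e0.
have /choice[h hP] : forall i, exists y, y \in H /\ g i = phi y.
  by move=> i; have /submod_imP[y yH ->] := gH i; exists y.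
pose F := submod_span h.
have sFH : {subset F <= H} by apply: span_sub => i; have [] := hP i.
have LF : (Lv (submod F) < +oo)%E.
  exact: (length_span_fin (navd_valuation hR) hLv hM).
have qe : (Lv (subquot (submod_add H (submod_im phi H))
    (submod_add H (submod_im phi F))) <= e%:E)%E.
  apply: gP => [x /submod_imP[y yF ->]|i].
    by apply/submod_imP; exists y => //; exact: sFH.
  by apply/submod_imP; exists (h i); [exact: mem_span|have [] := hP i].
have [l Hl] := cvg_intrinsic_ent_at LP Hin.
have [k Fk] := cvg_intrinsic_ent_at LP (inert_of_fin LP phi LF).
have {}Fk := cvg_ent_at LP LF Fk.
apply: (@le_trans _ _ (k%:E + e%:E)%E); last first.
  apply: leeD => //; apply: ereal_sup_ubound; exists F => //.
  exact: cvg_lim Fk.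
have {}Fk : (fun n => Lv (submod (trajectory phi F n)) * (n%:R^-1)%:E + e%:E)%E
    @ \oo --> (k%:E + e%:E)%E.
  by apply: cvgeD => //; exact: cvg_cst.
rewrite /intrinsic_ent_at -(cvg_lim _ Fk)//; apply: lee_lim.
- by apply/cvg_ex; exists l%:E.
- by apply/cvg_ex; exists (k%:E + e%:E)%E.
exists 1%N => // -[//|m] _.
rewrite -[X in (_ <= _ + X)%E](_ :
  (m.+1%:R * e)%:E * (m.+1%:R^-1)%:E = e%:E)%E; last first.
  by rewrite -EFinM mulrAC mulfV ?mul1r// pnatr_eq0.
rewrite -ge0_muleDl ?(length_ge0 LP)// ?lee_fin ?mulr_ge0 ?(ltW e0)//.
apply: lee_wpmul2r; first by rewrite lee_fin.
exact: (trajectory_length_approx LP sFH (ltW e0) qe).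
Qed.
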